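(* Let $\mathcal O=\mathcal{C}l(s,t)$, $k=2^{s+t}$, $m\in\mathbb N$, $\mathbb V=\mathbb R^{km}=\mathcal O^m$, and let $F_1,\dots,F_k$ be the standard basis of $\mathcal O$ acting on $\mathbb V$. Then there are coefficients $\epsilon_1,\dots,\epsilon_k\in\{\pm1\}$, depending only on the type of $\mathcal O$, such that for every one-form $\xi\in\mathbb V^*$ the map $S^\xi:\mathbb V\times\mathbb V\to\mathbb V$, $$S^{\xi}(X,Y)=S^\xi_X(Y)=\sum_{i=1}^{k}\epsilon_i\bigl(\xi(F_iX)F_iY+\xi(F_iY)F_iX\bigr),\qquad X,Y\in\mathbb V,$$ belongs to the first prolongation $\mathfrak g^{(1)}$ of the Lie algebra $\mathfrak g$ of the Lie group $GL(m,\mathcal O)GL(1,\mathcal O)$.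
   Context: The Clifford algebra $\mathcal O=\mathcal{C}l(s,t)$ is the real associative unital algebra of dimension $k=2^{s+t}$ generated by pairwise anticommuting elements $I_1,\dots,I_t$ with $I_i^2=-E$ and $J_1,\dots,J_s$ with $J_j^2=E$, $E$ the unit. Its standard basis $F_1,\dots,F_k$ consists of $F_1=E$, the generators $I_i$, $J_j$, and all products of two or more distinct generators (one for each subset of generators). These act on $\mathbb V=\mathcal O^m=\mathbb R^{km}$ blockwise through a matrix representation of $\mathcal O$ on $\mathbb R^k$. $GL(m,\mathcal O)=\{B\in GL(km,\mathbb R): BI_i=I_iB,\ BJ_j=J_jB\}$, with Lie algebra $\mathfrak{gl}(m,\mathcal O)=\{B\in\mathfrak{gl}(km,\mathbb R): BI_i=I_iB,\ BJ_j=J_jB\}$. $GL(1,\mathcal O)$ acts on $\mathbb V$ blockwise as the group of invertible elements of $\langle F_1,\dots,F_k\rangle$ (commuting with $GL(m,\mathcal O)$), and $G=GL(m,\mathcal O)GL(1,\mathcal O)$ is the group of products, with Lie algebra $\mathfrak g=\mathfrak{gl}(m,\mathcal O)+\langle F_1,\dots,F_k\rangle\subset\mathfrak{gl}(km,\mathbb R)$. For $\mathfrak g\subset\mathfrak{gl}(\mathbb V)$, the first prolongation $\mathfrak g^{(1)}$ is the space of symmetric bilinear maps $\tau:\mathbb V\times\mathbb V\to\mathbb V$ such that for each fixed $v_1\in\mathbb V$ the map $v\mapsto\tau(v,v_1)$ is in $\mathfrak g$. *)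

(* Defs.v *)
From HB Require Import structures.
From mathcomp Require Export all_boot all_order all_algebra all_field reals.

Set Implicit Arguments.
Unset Strict Implicit.
Unset Printing Implicit Defensive.

Import GRing.Theory.
Local Open Scope ring_scope.

(* The generators are numbered I_1, ..., I_t, J_1, ..., J_s. *)
Definition generator (T : Type) (s t : nat) (I : 'I_t -> T) (J : 'I_s -> T)
    (a : 'I_(t + s)) : T :=
  match split a with inl i => I i | inr j => J j end.

(* O, with the generators I and J, is a model of Cl(s, t).  The condition on the
   dimension excludes the proper quotients, in which the relations also hold. *)
Record is_clifford (R : realType) (s t : nat) (O : falgType R)
    (I : 'I_t -> O) (J : 'I_s -> O) : Prop := IsClifford {
  clifford_sqrI : forall i, I i ^+ 2 = -1;
  clifford_sqrJ : forall j, J j ^+ 2 = 1;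
  clifford_anticomm : forall a b, a != b ->
    generator I J a * generator I J b = - (generator I J b * generator I J a);
  clifford_gen : agenv <<[seq generator I J a | a : 'I_(t + s)]>>%VS = fullv;
  clifford_dim : \dim {:O} = (2 ^ (s + t))%N
}.

(* The standard basis is indexed by the sets of generators, instead of by
   1, ..., k: clifford_basis I J set0 = 1, and the factors of a product of
   several generators are multiplied in increasing order. *)
Definition clifford_basis (R : realType) (s t : nat) (O : falgType R)
    (I : 'I_t -> O) (J : 'I_s -> O) (S : {set 'I_(t + s)}) : O :=
  \prod_(a in S) generator I J a.

(* V = (R^k)^m is the space of column vectors of size k + ... + k (m terms). *)
Definition dimV (k m : nat) : nat := (\sum_(i < m) k)%N.

Definition blockwise (R : realType) (k m : nat) (A : 'M[R]_k) :
    'M[R]_(dimV k m) :=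
  \mxdiag_(i < m) A.

Section LieAlgebra.
Variables (R : realType) (s t k : nat) (O : falgType R).
Variables (I : 'I_t -> O) (J : 'I_s -> O).
Variables (rho : {lrmorphism O -> 'M[R]_k}) (m : nat).

Definition in_gl (B : 'M[R]_(dimV k m)) : Prop :=
  (forall i, comm_mx B (blockwise m (rho (I i)))) /\
  (forall j, comm_mx B (blockwise m (rho (J j)))).

(* gl(m, O) + <F_1, ..., F_k>, the Lie algebra of GL(m, O) GL(1, O) *)
Definition in_g (A : 'M[R]_(dimV k m)) : Prop :=
  exists (B : 'M[R]_(dimV k m)) (c : {set 'I_(t + s)} -> R),
    in_gl B /\
    A = B + \sum_S c S *: blockwise m (rho (clifford_basis I J S)).

Definition S_map (eps : {set 'I_(t + s)} -> R)
    (xi : {scalar 'cV[R]_(dimV k m)}) (X Y : 'cV[R]_(dimV k m)) :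
    'cV[R]_(dimV k m) :=
  \sum_(S : {set 'I_(t + s)})
    let F := blockwise m (rho (clifford_basis I J S)) in
    eps S *: (xi (F *m X) *: (F *m Y) + xi (F *m Y) *: (F *m X)).

End LieAlgebra.

Definition first_prolongation (R : realType) (n : nat) (g : 'M[R]_n -> Prop)
    (tau : 'cV[R]_n -> 'cV[R]_n -> 'cV[R]_n) : Prop :=
  [/\ forall X Y, tau X Y = tau Y X,
      forall X, linear (tau X),
      forall Y, linear (tau^~ Y)
    & forall v1, exists2 A, g A & forall v, tau v v1 = A *m v].

(* Main.v *)
(** The tensor [\sum_S eps S *: (F S (x) F S)] is the Casimir element
    [\sum_S F S^-1 (x) F S] of the Clifford algebra, where [eps S = F S ^ 2] is a
    sign.  Left multiplication by a generator permutes the standard basis up to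
    signs, so [\sum_S eps S *: (F S *m M *m F S)] commutes with the generators
    for every matrix [M].  For [M = v *m w], with [w] the row of [xi], this
    handles the terms [xi (F S X) *: F S v]; the remaining terms
    [xi (F S v) *: F S X] are visibly in the span of the [F S]. *)
Require Import Defs.
From mathcomp Require Import zify.

Set Implicit Arguments.
Unset Strict Implicit.
Unset Printing Implicit Defensive.

Import GRing.Theory.
Local Open Scope ring_scope.

Section Anticommuting.
Variables (A : pzRingType) (T : eqType) (g : T -> A) (neg : pred T).
Hypothesis g_sqr : forall a, g a ^+ 2 = (-1) ^+ neg a.
Hypothesis g_anticomm : forall a b, a != b -> g a * g b = - (g b * g a).

(* ['C(size r, 2)] transpositions bring the equal factors of the square of the
   product over [r] together. *)
Definition sqr_exponent (r : seq T) : nat := (count neg r + 'C(size r, 2))%N.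

Lemma mulr_prod_notin a r : a \notin r ->
  g a * (\prod_(b <- r) g b) = (-1) ^+ size r * ((\prod_(b <- r) g b) * g a).
Proof.
elim: r => [|b r IHr]; first by rewrite big_nil !mul1r mulr1.
rewrite inE negb_or => /andP[neq_ab /IHr ga_r].
rewrite big_cons mulrA g_anticomm // mulNr -!mulrA ga_r exprS mulN1r mulNr.
by congr (- _); rewrite !mulrA commr_sign.
Qed.

(** Here [a] may occur in [r]; [g a] commutes with itself, so the sign is no longer fixed by the
    length of [r]. *)
Lemma mulr_prod_sign a r : exists e : nat,
  g a * (\prod_(b <- r) g b) = (-1) ^+ e * ((\prod_(b <- r) g b) * g a).
Proof.
elim: r => [|b r [e ga_r]]; first by exists 0%N; rewrite big_nil !mul1r mulr1.
rewrite big_cons; have [<-|neq_ab] := eqVneq a b.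
  by exists e; rewrite -mulrA ga_r [in LHS]mulrA commr_sign -mulrA.
exists e.+1; rewrite mulrA g_anticomm // mulNr -!mulrA ga_r exprS mulN1r mulNr.
by congr (- _); rewrite !mulrA commr_sign.
Qed.

Lemma prod_perm_sign r1 r2 : perm_eq r1 r2 -> exists e : nat,
  \prod_(b <- r1) g b = (-1) ^+ e * \prod_(b <- r2) g b.
Proof.
elim: r1 r2 => [|a r1 IHr] r2.
  by rewrite perm_sym => /perm_nilP ->; exists 0%N; rewrite mul1r.
move=> eq_r12; have : a \in r2 by rewrite -(perm_mem eq_r12) mem_head.
move=> /path.splitPr def_r2; case: def_r2 eq_r12 => s1 s2.
rewrite perm_sym -cat1s perm_catCA perm_cons perm_sym => /IHr[e1 r1E].
(* The sign [e2] pays for moving [g a] back past the prefix [s1] of [r2]. *)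
have [e2 s1E] := mulr_prod_sign a s1; exists (e1 + e2)%N.
rewrite big_cons r1E !big_cat big_seq1 /= (mulrA (g a)) commr_sign.
by rewrite -mulrA (mulrA (g a)) s1E exprD -!mulrA.
Qed.

Lemma prod_sqr r : uniq r ->
  (\prod_(b <- r) g b) ^+ 2 = (-1) ^+ sqr_exponent r.
Proof.
elim: r => [|a r IHr]; first by rewrite big_nil expr1n.
move=> /= /andP[/mulr_prod_notin ga_r /IHr r_sqr]; rewrite big_cons.
rewrite expr2 {1}ga_r -!mulrA (mulrA (g a)) -expr2 g_sqr.
rewrite (mulrA (\prod_(b <- r) g b)) commr_sign -mulrA -expr2 r_sqr -!exprD.
(* Pascal's rule: the [size r] signs from moving [g a] past [r] raise 'C(n, 2) to 'C(n + 1, 2). *)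
by rewrite /sqr_exponent /= binS bin1; congr (_ ^+ _); lia.
Qed.

End Anticommuting.

(** The families [F] and [eps *: F] transform dually: the scalar [c] from multiplying by [G] on the
    left of one reappears on the right of the other, so reindexing along [h] matches the two sums
    termwise. *)
Lemma casimir_comm (R : comPzRingType) (N : finType) (n : nat) (h : N -> N)
    (eps : N -> R) (F : N -> 'M[R]_n) (G M : 'M[R]_n) :
    involutive h ->
    (forall i, exists c : R, G *m F i = c *: F (h i) /\
       eps (h i) *: (F (h i) *m G) = (c * eps i) *: F i) ->
  comm_mx (\sum_i eps i *: (F i *m M *m F i)) G.
Proof.
move=> hK FG; rewrite /comm_mx mulmx_suml mulmx_sumr.
rewrite (reindex_inj (inv_inj hK)); apply: eq_bigr => i _.
have [c [GF FhG]] := FG i.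
rewrite -scalemxAl -mulmxA scalemxAr FhG -!scalemxAr !mulmxA GF.
by rewrite -!scalemxAl scalerA mulrC.
Qed.

Lemma scaler_signM (R : pzRingType) (A : lalgType R) (n : nat) (x : A) :
  (-1) ^+ n *: x = (-1) ^+ n * x.
Proof. by rewrite -signr_odd -[in RHS]signr_odd scaler_sign mulr_sign. Qed.

(** The square of a basis element, computed from the indices alone so that it is independent of the
    model; the indices below [t] are those of the generators of square -1. *)
Definition clifford_sign (R : pzRingType) (s t : nat)
    (S : {set 'I_(t + s)}) : R :=
  (-1) ^+ sqr_exponent (fun a : 'I_(t + s) => (a < t)%N) (enum S).

(** Symmetric difference with the singleton of [a]: the effect on index sets of multiplying by a
    generator. *)
Definition toggle (T : finType) (a : T) (S : {set T}) : {set T} :=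
  if a \in S then S :\ a else a |: S.

Lemma toggleK (T : finType) (a : T) : involutive (toggle a).
Proof.
move=> S; rewrite /toggle; have [aS|aS] := boolP (a \in S).
  by rewrite setD11 setD1K.
by rewrite setU11 setU1K.
Qed.

Section CliffordBasis.
Variables (R : realType) (s t : nat) (O : falgType R).
Variables (I : 'I_t -> O) (J : 'I_s -> O).
Hypothesis cliffordIJ : is_clifford I J.

Local Notation G := (generator I J).
Local Notation F := (clifford_basis I J).
Local Notation eps := (@clifford_sign R s t).

Lemma generator_sqr a : G a ^+ 2 = (-1) ^+ (a < t)%N.
Proof.
rewrite /generator; case: splitP => [i _|j _].
  exact: clifford_sqrI cliffordIJ i.
exact: clifford_sqrJ cliffordIJ j.
Qed.

Lemma clifford_basisE S : F S = \prod_(a <- enum S) G a.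
Proof. by rewrite /clifford_basis -big_filter [index_enum _]unlock. Qed.

Lemma clifford_basis_sqr S : F S * F S = eps S *: 1.
Proof.
rewrite -expr2 clifford_basisE scaler_signM mulr1.
exact: (prod_sqr generator_sqr (clifford_anticomm cliffordIJ) (enum_uniq _)).
Qed.

Lemma clifford_signK S (x : O) : eps S *: (eps S *: x) = x.
Proof. by rewrite scalerA -expr2 sqrr_sign scale1r. Qed.

Lemma generator_mul_basis a S : exists e : nat,
  G a * F S = (-1) ^+ e * F (toggle a S).
Proof.
have add_gen (S' : {set 'I_(t + s)}) : a \notin S' -> exists e : nat,
    G a * F S' = (-1) ^+ e * F (a |: S').
  move=> aS'; have : perm_eq (a :: enum S') (enum (a |: S')).
    apply: uniq_perm; rewrite /= ?enum_uniq ?mem_enum ?aS' // => b.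
    by rewrite inE !mem_enum in_setU1.
  case/(prod_perm_sign (clifford_anticomm cliffordIJ)) => e FE.
  by exists e; rewrite !clifford_basisE -FE big_cons.
rewrite /toggle; case: ifPn => [aS|]; last exact: add_gen.
(* If [a] is in [S], write [F S] as a signed [G a * F (S :\ a)] and absorb the square of [G a]. *)
have [|e] := add_gen (S :\ a); first by rewrite setD11.
rewrite setD1K // => FE; exists (e + (a < t))%N.
rewrite -[F S](signrMK e) -FE mulrA commr_sign -mulrA (mulrA (G a)) -expr2.
by rewrite generator_sqr mulrA exprD.
Qed.

(** Since [eps S *: F S] is the inverse of [F S], the second identity comes from the first on
    multiplying by [F (toggle a S)] on the left and by [F S] on the right. *)
Lemma clifford_basis_dual a S : exists c : R,
  G a * F S = c *: F (toggle a S) /\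
  eps (toggle a S) *: (F (toggle a S) * G a) = (c * eps S) *: F S.
Proof.
have [e GF] := generator_mul_basis a S; exists ((-1) ^+ e).
rewrite -scaler_signM in GF; split=> //.
rewrite -[RHS](clifford_signK (toggle a S)); congr (_ *: _).
rewrite -[LHS](clifford_signK S) -[X in eps S *: (eps S *: X)]mulr1.
rewrite scalerAr -clifford_basis_sqr -(mulrA _ (G a)) (mulrA (G a)) GF.
rewrite -!scalerAl -!scalerAr mulrA clifford_basis_sqr -scalerAl mul1r.
by rewrite !scalerA mulrC [eps S * _]mulrC.
Qed.

End CliffordBasis.

Section Blockwise.
Variables (R : realType) (k m : nat).

Lemma blockwiseM (A B : 'M[R]_k) :
  blockwise m (A *m B) = blockwise m A *m blockwise m B.
Proof.
rewrite /blockwise [\mxdiag__ B]/mxdiag mul_mxdiag_mxblock.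
apply: eq_mxblock => i j; case: eqP => _; last by rewrite mulmx0.
by rewrite !conform_mx_id.
Qed.

Lemma blockwiseZ a (A : 'M[R]_k) : blockwise m (a *: A) = a *: blockwise m A.
Proof.
by rewrite -mul_scalar_mx blockwiseM /blockwise mxdiagZ mul_scalar_mx.
Qed.

End Blockwise.

(** With [xi] as a row, a term [xi (F X) *: F v] becomes a matrix product applied to [X]. *)
Lemma mul_row_scalar (R : comPzRingType) (n : nat) (xi : {scalar 'cV[R]_n}) X :
  (\row_j xi (delta_mx j 0)) *m X = (xi X)%:M.
Proof.
apply/matrixP => i j; rewrite !ord1 !mxE eqxx mulr1n.
rewrite [in RHS](matrix_sum_delta X) linear_sum; apply: eq_bigr => l _.
by rewrite big_ord1 linearZ mxE mulrC.
Qed.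

Theorem theorem5p3 (R : realType) (s t : nat) :
  exists eps : {set 'I_(t + s)} -> R,
    (forall S, eps S = 1 \/ eps S = -1) /\
    forall (O : falgType R) (I : 'I_t -> O) (J : 'I_s -> O)
      (rho : {lrmorphism O -> 'M[R]_(2 ^ (s + t))}) (m : nat)
      (xi : {scalar 'cV[R]_(dimV (2 ^ (s + t)) m)}),
      is_clifford I J ->
      first_prolongation (in_g I J rho (m := m)) (S_map I J rho eps xi).
Proof.
exists (@clifford_sign R s t); split.
  move=> S; rewrite /clifford_sign -signr_odd; case: odd; last by left.
  by right.
move=> O I J rho m xi cliffordIJ.
set eps := @clifford_sign R s t.
pose F S := blockwise m (rho (clifford_basis I J S)).
have rhoM x y : rho (x * y) = rho x *m rho y by rewrite rmorphM.
have rhoZ c x : rho (c *: x) = c *: rho x by rewrite linearZ.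
have S_mapC X Y : S_map I J rho eps xi X Y = S_map I J rho eps xi Y X.
  by apply: eq_bigr => S _; rewrite /= addrC.
have S_map_linear X : linear (S_map I J rho eps xi X).
  move=> a Y Z; rewrite /S_map scaler_sumr -big_split /=; apply: eq_bigr => S _.
  rewrite mulmxDr -scalemxAr (linearP xi) /= !scalerDr scalerDl !scalerDr.
  rewrite !scalerA addrACA; congr (_ *: _ + _ *: _ + _).
    by rewrite mulrC mulrA.
  by rewrite mulrCA mulrA.
split=> // [Y a X Z|v].
  (* Linearity in the first argument follows by symmetry. *)
  by rewrite ![S_map _ _ _ _ _ _ Y]S_mapC S_map_linear.
pose w := \row_j xi (delta_mx j 0).
pose B := \sum_S eps S *: (F S *m (v *m w) *m F S).
have comm_B a : comm_mx B (blockwise m (rho (generator I J a))).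
  apply: (casimir_comm _ (toggleK a)) => S.
  have [c [GF FG]] := clifford_basis_dual cliffordIJ a S; exists c.
  (* Both relations are pulled back along [rho] and [blockwise] to identities in [O]. *)
  rewrite /F -!blockwiseM -!blockwiseZ -!rhoM -!rhoZ.
  by rewrite GF FG.
exists (B + \sum_S (eps S * xi (F S *m v)) *: F S).
  exists B, (fun S => eps S * xi (F S *m v)); split=> //; split=> [i|j].
    have := comm_B (lshift s i).
    by rewrite /generator (unsplitK (inl i)).
  have := comm_B (rshift t j).
  by rewrite /generator (unsplitK (inr j)).
move=> X; rewrite mulmxDl !mulmx_suml -big_split /=; apply: eq_bigr => S _.
rewrite -!scalemxAl -!mulmxA mul_row_scalar !mul_mx_scalar -scalemxAr.
by rewrite -scalerA -scalerDr.
Qed.
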